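(* There exists no $\phi$-recurrent Sasakian manifold. That is, for every $n\geq 1$, no Sasakian manifold $M^{2n+1}(\phi,\xi,\eta,g)$ is $\phi$-recurrent.
   Context: A contact metric manifold $M^{2n+1}(\phi,\xi,\eta,g)$ is a smooth $(2n+1)$-dimensional manifold with a global 1-form $\eta$ satisfying $\eta\wedge(d\eta)^n\neq 0$ everywhere, a global vector field $\xi$, a $(1,1)$-tensor field $\phi$ and a Riemannian metric $g$ such that $\eta(\xi)=1$, $\phi^2=-\mathrm{Id}+\eta\otimes\xi$, $g(\phi X,\phi Y)=g(X,Y)-\eta(X)\eta(Y)$ and $d\eta(X,Y)=g(X,\phi Y)$ for all vector fields $X,Y$, with the convention $d\eta(X,Y)=\frac12\big(X\eta(Y)-Y\eta(X)-\eta([X,Y])\big)$. Let $\nabla$ be the Levi-Civita connection of $g$ and $R(X,Y)Z=\nabla_X\nabla_YZ-\nabla_Y\nabla_XZ-\nabla_{[X,Y]}Z$ its curvature tensor. A contact metric manifold is Sasakian if the almost complex structure it induces on $M\times\mathbb{R}$ is integrable; equivalently, if $R(X,Y)\xi=\eta(Y)X-\eta(X)Y$ for all vector fields $X,Y$. A contact metric manifold is $\phi$-recurrent if there exists a non-zero (i.e. not identically zero) 1-form $A$ on $M$ such that $\phi^2((\nabla_WR)(X,Y)Z)=A(W)R(X,Y)Z$ for all vector fields $X,Y,Z,W$ on $M$. *)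

(* Defs.v *)
From HB Require Import structures.
From mathcomp Require Import all_boot all_order all_algebra all_fingroup.
From mathcomp Require Import all_classical all_reals all_analysis.

Set Implicit Arguments.
Unset Strict Implicit.
Unset Printing Implicit Defensive.

Import Order.TTheory GRing.Theory Num.Theory.
Import numFieldNormedType.Exports.

Local Open Scope classical_set_scope.
Local Open Scope ring_scope.

Section Euclidean.
Context {R : realType}.

(* [f] is of class C^k on [U]; only meant for open [U], the directional
   derivatives being those of the ambient space. *)
Fixpoint Ck (m k : nat) (U : set 'rV[R]_m) (f : 'rV[R]_m -> R) : Prop :=
  (forall x, U x -> {for x, continuous f}) /\
  if k is k'.+1 then
    forall i : 'I_m, (forall x, U x -> derivable f x (delta_mx 0 i)) /\
                     Ck k' U (fun x => 'D_(delta_mx 0 i) f x)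
  else True.

Definition smooth_on (m : nat) (U : set 'rV[R]_m) (f : 'rV[R]_m -> R) : Prop :=
  forall k, Ck k U f.

End Euclidean.

Section Manifolds.
Context (R : realType).

(* The maps are total; only their values on the domain, resp. on the image,
   of the chart are meaningful. *)
Record chart (m : nat) (M : topologicalType) := Chart {
  chart_dom : set M;
  chart_img : set 'rV[R]_m;
  chart_map : M -> 'rV[R]_m;
  chart_inv : 'rV[R]_m -> M;
  chart_dom_open : open chart_dom;
  chart_img_open : open chart_img;
  chart_map_img : forall p, chart_dom p -> chart_img (chart_map p);
  chart_inv_dom : forall x, chart_img x -> chart_dom (chart_inv x);
  chart_mapK : forall p, chart_dom p -> chart_inv (chart_map p) = p;
  chart_invK : forall x, chart_img x -> chart_map (chart_inv x) = x;
  chart_map_continuous : forall p, chart_dom p -> {for p, continuous chart_map};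
  chart_inv_continuous : forall x, chart_img x -> {for x, continuous chart_inv}
}.

Record smooth_manifold (m : nat) := SmoothManifold {
  carrier :> topologicalType;
  manifold_hausdorff : hausdorff_space carrier;
  manifold_second_countable : @second_countable carrier;
  atlas : set (chart m carrier);
  atlas_cover : forall p : carrier, exists2 c, atlas c & chart_dom c p;
  atlas_compatible : forall c d, atlas c -> atlas d -> forall j : 'I_m,
    smooth_on (chart_img c `&` [set x | chart_dom d (chart_inv c x)])
              (fun x => chart_map d (chart_inv c x) 0 j)
}.

End Manifolds.

Section Calculus.
Context {R : realType} {m : nat} (M : smooth_manifold R m).

Definition smooth : set (M -> R) :=
  [set f : M -> R | forall c : chart R m M, atlas c ->
     smooth_on (chart_img c) (fun x => f (chart_inv c x))].

(* Tangent vectors are derivations of the algebra of smooth functions. They are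
   given as functionals on all functions, with value 0 outside of this algebra:
   equality of tangent vectors is then Leibniz equality. *)
Definition functional : Type := (M -> R) -> R.

Definition tangent (p : M) : set functional :=
  [set v : functional | [/\ forall (a : R) f g, smooth f -> smooth g ->
                 v (fun q => a * f q + g q) = a * v f + v g,
               forall f g, smooth f -> smooth g ->
                 v (fun q => f q * g q) = v f * g p + f p * v g &
               forall f, ~ smooth f -> v f = 0]].

Definition vadd (v w : functional) : functional := fun f => v f + w f.
Definition vscale (a : R) (v : functional) : functional := fun f => a * v f.
Definition vsub (v w : functional) : functional := fun f => v f - w f.

Definition vfield : Type := M -> functional.

Definition app (X : vfield) (f : M -> R) : M -> R := fun p => X p f.

Definition vector_field : set vfield :=
  [set X : vfield | (forall p, tangent p (X p)) /\
           (forall f, smooth f -> smooth (app X f))].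

Definition fadd (X Y : vfield) : vfield := fun p => vadd (X p) (Y p).
Definition fsub (X Y : vfield) : vfield := fun p => vsub (X p) (Y p).
Definition fscale (f : M -> R) (X : vfield) : vfield :=
  fun p => vscale (f p) (X p).

Definition bracket (X Y : vfield) : vfield :=
  fun p f => X p (app Y f) - Y p (app X f).

Definition one_form (a : M -> functional -> R) : Prop :=
  (forall p v w (c : R), tangent p v -> tangent p w ->
     a p (vadd (vscale c v) w) = c * a p v + a p w) /\
  (forall X, vector_field X -> smooth (fun p => a p (X p))).

Definition ext_deriv (a : M -> functional -> R) (X Y : vfield) : M -> R :=
  fun p => 2^-1 * (X p (fun q => a q (Y q)) - Y p (fun q => a q (X q))
                   - a p (bracket X Y p)).

Definition tensor11 (F : M -> functional -> functional) : Prop :=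
  [/\ forall p v, tangent p v -> tangent p (F p v),
      forall p v w (c : R), tangent p v -> tangent p w ->
        F p (vadd (vscale c v) w) = vadd (vscale c (F p v)) (F p w) &
      forall X, vector_field X -> vector_field (fun p => F p (X p))].

Definition riemannian_metric (g : M -> functional -> functional -> R) : Prop :=
  [/\ forall p v w, tangent p v -> tangent p w -> g p v w = g p w v,
      forall p u v w (c : R), tangent p u -> tangent p v -> tangent p w ->
        g p (vadd (vscale c u) v) w = c * g p u w + g p v w,
      forall p v, tangent p v -> v <> (fun=> 0) -> 0 < g p v v &
      forall X Y, vector_field X -> vector_field Y ->
        smooth (fun p => g p (X p) (Y p))].

Definition affine_connection (nabla : vfield -> vfield -> vfield) : Prop :=
  [/\ forall X Y, vector_field X -> vector_field Y ->
        vector_field (nabla X Y),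
      forall f X Y Z, smooth f ->
        vector_field X -> vector_field Y -> vector_field Z ->
        nabla (fadd (fscale f X) Y) Z = fadd (fscale f (nabla X Z)) (nabla Y Z),
      forall X Y Z, vector_field X -> vector_field Y -> vector_field Z ->
        nabla X (fadd Y Z) = fadd (nabla X Y) (nabla X Z) &
      forall f X Y, smooth f -> vector_field X -> vector_field Y ->
        nabla X (fscale f Y) = fadd (fscale (app X f) Y) (fscale f (nabla X Y))].

Definition levi_civita (g : M -> functional -> functional -> R)
    (nabla : vfield -> vfield -> vfield) : Prop :=
  [/\ affine_connection nabla,
      forall X Y, vector_field X -> vector_field Y ->
        fsub (nabla X Y) (nabla Y X) = bracket X Y &
      forall X Y Z, vector_field X -> vector_field Y -> vector_field Z ->
        forall p, X p (fun q => g q (Y q) (Z q)) =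
                  g p (nabla X Y p) (Z p) + g p (Y p) (nabla X Z p)].

Definition curvature (nabla : vfield -> vfield -> vfield) (X Y Z : vfield) : vfield :=
  fsub (fsub (nabla X (nabla Y Z)) (nabla Y (nabla X Z)))
       (nabla (bracket X Y) Z).

Definition nabla_curvature (nabla : vfield -> vfield -> vfield)
    (W X Y Z : vfield) : vfield :=
  let Rm := curvature nabla in
  fsub (fsub (fsub (nabla W (Rm X Y Z)) (Rm (nabla W X) Y Z))
             (Rm X (nabla W Y) Z))
       (Rm X Y (nabla W Z)).

End Calculus.

Arguments smooth {R m} M _.
Arguments functional {R m} M.
Arguments tangent {R m} M p _.
Arguments vfield {R m} M.
Arguments vector_field {R m} M _.

Section Contact.
Context {R : realType} {n : nat} (M : smooth_manifold R n.*2.+1).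

(* A positive multiple of (eta /\ (d eta)^n)(X_0, ..., X_2n). *)
Definition contact_volume (eta : M -> functional M -> R)
    (X : 'I_n.*2.+1 -> vfield M) (p : M) : R :=
  \sum_(s : 'S_(n.*2.+1)) (-1) ^+ s * eta p (X (s ord0) p) *
    \prod_(i < n) ext_deriv eta (X (s (inord i.*2.+1)))
                                (X (s (inord i.*2.+2))) p.

Record contact_metric := ContactMetric {
  phi : M -> functional M -> functional M;
  xi : vfield M;
  eta : M -> functional M -> R;
  g : M -> functional M -> functional M -> R;
  phi_tensor : tensor11 phi;
  xi_field : vector_field M xi;
  eta_form : one_form eta;
  g_metric : riemannian_metric g;
  eta_contact : forall p, exists2 X : 'I_n.*2.+1 -> vfield M,
    (forall i, vector_field M (X i)) & contact_volume eta X p != 0;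
  eta_xi : forall p, eta p (xi p) = 1;
  phi_phi : forall X, vector_field M X -> forall p,
    phi p (phi p (X p)) = vsub (vscale (eta p (X p)) (xi p)) (X p);
  g_phi : forall X Y, vector_field M X -> vector_field M Y -> forall p,
    g p (phi p (X p)) (phi p (Y p)) =
    g p (X p) (Y p) - eta p (X p) * eta p (Y p);
  deta_g : forall X Y, vector_field M X -> vector_field M Y -> forall p,
    ext_deriv eta X Y p = g p (X p) (phi p (Y p))
}.

End Contact.

(* Vector fields on M x R, with t the coordinate on R. Through
   T_(p,t)(M x R) = T_p M + R d/dt, such a field is a pair (X, f), written
   X + f d/dt, with X (p, t) tangent to M at p and f a function on M x R. *)
Section Cylinder.
Context {R : realType} {m : nat} (M : smooth_manifold R m).

(* Smoothness in the product charts c x id. *)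
Definition smooth_cyl : set (M * R -> R) :=
  [set f : M * R -> R | forall c : chart R m M, atlas c ->
     smooth_on [set z : 'rV[R]_(m + 1) | chart_img c (lsubmx z)]
               (fun z => f (chart_inv c (lsubmx z), rsubmx z 0 0))].

Definition cyl_field : Type := ((M * R -> functional M) * (M * R -> R))%type.

(* As the functions h o pr_1, for h smooth on M, contain local coordinates of
   the factor M, it is enough to test the smoothness of X on them. *)
Definition cyl_vector_field : set cyl_field :=
  [set V : cyl_field | [/\ forall q, tangent M q.1 (V.1 q),
               forall h, smooth M h -> smooth_cyl (fun q => V.1 q h) &
               smooth_cyl V.2]].

Definition cyl_app (V : cyl_field) (k : M * R -> R) : M * R -> R :=
  fun q => V.1 q (fun p => k (p, q.2)) + V.2 q * derive1 (fun t => k (q.1, t)) q.2.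

(* The component along M is determined by its action on the h o pr_1, that
   along R by its action on t. *)
Definition cyl_bracket (V W : cyl_field) : cyl_field :=
  (fun q h => cyl_app V (fun q' => W.1 q' h) q
              - cyl_app W (fun q' => V.1 q' h) q,
   fun q => cyl_app V W.2 q - cyl_app W V.2 q).

Definition cyl_add (V W : cyl_field) : cyl_field :=
  (fun q => vadd (V.1 q) (W.1 q), fun q => V.2 q + W.2 q).
Definition cyl_sub (V W : cyl_field) : cyl_field :=
  (fun q => vsub (V.1 q) (W.1 q), fun q => V.2 q - W.2 q).
Definition cyl_zero : cyl_field := (fun _ _ => 0, fun=> 0).

(* Nijenhuis torsion [J, J] of J. *)
Definition nijenhuis (J : cyl_field -> cyl_field) (V W : cyl_field) : cyl_field :=
  cyl_sub (cyl_sub (cyl_add (J (J (cyl_bracket V W))) (cyl_bracket (J V) (J W)))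
                   (J (cyl_bracket (J V) W)))
          (J (cyl_bracket V (J W))).

(* Integrability of an almost complex structure, in the sense of a vanishing
   torsion. *)
Definition integrable (J : cyl_field -> cyl_field) : Prop :=
  forall V W, cyl_vector_field V -> cyl_vector_field W ->
    nijenhuis J V W = cyl_zero.

End Cylinder.

Section Sasakian.
Context {R : realType} {n : nat} {M : smooth_manifold R n.*2.+1}.
Implicit Type S : contact_metric M.

(* J (X + f d/dt) = (phi X - f xi) + eta(X) d/dt. *)
Definition cyl_J S (V : cyl_field M) : cyl_field M :=
  (fun q => vsub (phi S q.1 (V.1 q)) (vscale (V.2 q) (xi S q.1)),
   fun q => eta S q.1 (V.1 q)).

Definition sasakian S : Prop := integrable (cyl_J S).

Definition phi_recurrent S (nabla : vfield M -> vfield M -> vfield M) : Prop :=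
  exists A : M -> functional M -> R,
    [/\ one_form A,
        exists2 W, vector_field M W & exists p, A p (W p) != 0 &
        forall X Y Z W, vector_field M X -> vector_field M Y ->
          vector_field M Z -> vector_field M W -> forall p,
          phi S p (phi S p (nabla_curvature nabla W X Y Z p)) =
          vscale (A p (W p)) (curvature nabla X Y Z p)].

End Sasakian.

(* Main.v *)
Require Import Defs.
From mathcomp Require Import all_boot all_order all_algebra all_reals.
From mathcomp Require Import all_classical all_analysis.
From mathcomp Require Import ring lra.

Set Implicit Arguments.
Unset Strict Implicit.
Unset Printing Implicit Defensive.

Import Order.TTheory GRing.Theory Num.Theory.
Import numFieldNormedType.Exports.

(** Since [phi^2 = - id + eta (x) xi], the left-hand side of the recurrence
    identity is annihilated by [eta]. At a point [p] and a field [W] with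
    [A(W) <> 0] at [p] the identity therefore forces [eta (R(X,Y)Z) = 0] at [p]
    for all [X, Y, Z], and a Sasakian manifold does not allow this.

    With [eta = <., xi>] and the skew-symmetry of the curvature
    ([curvature_skew]), taking [Y = xi] and [Z = X] gives
    [<R(X,xi)xi, X> = 0]. But the Reeb field [xi] of a Sasakian manifold is a
    Killing field ([killing_xi]) with geodesic integral curves
    ([xi_geodesic]), and for such a field [<R(X,xi)xi, X> = |nabla_X xi|^2]
    ([curvature_killing]). Hence [nabla xi] vanishes at [p]; as
    [2 d eta(X,Y) = <nabla_X xi, Y> - <nabla_Y xi, X>] ([ext_deriv_eta]), so
    does [d eta], and [eta /\ (d eta)^n] would be zero at [p] for [n >= 1].

    That [xi] is Killing is where the integrability of [J] enters. The
    Nijenhuis torsion of [J] on the pair [(X, d/dt)] has the component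
    [phi [X,xi] - [phi X,xi]] along [M], so that [L_xi phi = 0]
    ([bracket_xi_phi]). The identity [L_xi (d eta) = 0] holds on every contact
    metric manifold ([lie_xi_ext_deriv]). As [d eta = <., phi .>], both
    together give [(L_xi g)(X, phi Y) = 0], and the remaining direction
    [Y = xi] is covered by [nabla_xi xi = 0] and [|xi| = 1].

    All identities are between global vector fields, which is enough because
    the contact condition provides global fields on which [eta /\ (d eta)^n]
    is non-zero at [p]. *)

Local Open Scope classical_set_scope.
Local Open Scope ring_scope.

(** * Functions of class C^k on open sets *)

Section EuclideanSmoothness.
Context {R : realType}.

(** Openness makes the partial derivatives on [U] depend only on the values on
    [U]. *)
Lemma Ck_ext m k (U : set 'rV[R]_m) (f h : 'rV[R]_m -> R) :
  open U -> (forall x, U x -> f x = h x) -> Ck k U f -> Ck k U h.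
Proof.
move=> oU; elim: k f h => [|k IH] f h fh [cf df].
all: have nfh x : U x -> \forall y \near x, f y = h y
  by move=> Ux; apply: filterS (open_nbhs_nbhs (conj oU Ux)) => y; exact: fh.
all: have ch x : U x -> {for x, continuous h}
  by move=> Ux; have cfx : f y @[y --> x] --> f x := cf x Ux;
    rewrite (fh x Ux) in cfx; exact: cvg_trans (near_eq_cvg (nfh _ Ux)) cfx.
  by [].
split=> // i; have [dfi Cf] := df i; split.
  by move=> x Ux; exact: near_eq_derivable (nfh _ Ux) (dfi x Ux).
by apply: IH Cf => x Ux; exact: near_eq_derive (nfh _ Ux).
Qed.

Lemma Ck_cst m k (U : set 'rV[R]_m) (a : R) : Ck k U (fun=> a).
Proof.
elim: k a => [|k IH] a; split => //; try by move=> x _; exact: (@cst_continuous _ _ a).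
move=> i; split=> [x _|]; first exact: (derivable_cst a x).
have -> : (fun x : 'rV[R]_m => 'D_(delta_mx 0 i) (fun=> a) x) = (fun=> 0); last exact: IH.
by apply/funext => x; exact: (derive_cst a x).
Qed.

Lemma Ck_lin m k (U : set 'rV[R]_m) (a : R) (f h : 'rV[R]_m -> R) :
  open U -> Ck k U f -> Ck k U h -> Ck k U (fun x => a * f x + h x).
Proof.
move=> oU; elim: k f h => [|k IH] f h [cf df] [ch dh].
all: have cfh x : U x -> {for x, continuous (fun x => a * f x + h x)}
  by move=> Ux; exact: (cvgD (cvgM (cvg_cst a) (cf x Ux)) (ch x Ux)).
  by [].
split=> // i.
have [dfi Cf] := df i; have [dhi Ch] := dh i; split.
  move=> x Ux; apply: derivableD; last exact: dhi.
  exact: derivableZ (dfi x Ux).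
apply: Ck_ext (IH _ _ Cf Ch) => // x Ux.
rewrite deriveD; [|exact: derivableZ (dfi x Ux)|exact: dhi].
by rewrite deriveZ //; exact: dfi.
Qed.

Lemma continuous_lsubmx m d : continuous (@lsubmx R 1 m d).
Proof.
move=> z A /nbhs_ballP[e e0 eA]; apply/nbhs_ballP; exists e => // t [_ zt].
by apply: eA; split=> // i j; rewrite !mxE; exact: zt.
Qed.

(** The difference quotients of [f o lsubmx] are literally those of [f], because
    [lsubmx] is linear. *)
Lemma derivable_lsubmx m d (f : 'rV[R]_m -> R) (z v : 'rV[R]_(m + d)) :
  derivable (fun z => f (lsubmx z)) z v = derivable f (lsubmx z) (lsubmx v).
Proof.
apply: (congr1 (fun u : R -> R => cvg (u @ 0^'))); apply/funext => h /=.
by rewrite -linearP.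
Qed.

Lemma derive_lsubmx m d (f : 'rV[R]_m -> R) (z v : 'rV[R]_(m + d)) :
  'D_v (fun z => f (lsubmx z)) z = 'D_(lsubmx v) f (lsubmx z).
Proof.
apply: (congr1 (fun u : R -> R => lim (u @ 0^'))); apply/funext => h /=.
by rewrite -linearP.
Qed.

(** The induction stays within functions of the form [f o lsubmx]: a partial
    derivative along one of the first [m] coordinates is again of this form, and
    those along the others vanish identically. *)
Lemma Ck_lsubmx m d k (U : set 'rV[R]_m) (f : 'rV[R]_m -> R) :
  Ck k U f -> Ck k [set z : 'rV[R]_(m + d) | U (lsubmx z)] (fun z => f (lsubmx z)).
Proof.
elim: k f => [|k IH] f [cf df].
all: have cfl z : U (lsubmx z) ->
    {for z, continuous (fun z : 'rV[R]_(m + d) => f (lsubmx z))}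
  by move=> Uz; exact: (continuous_comp (@continuous_lsubmx m d z) (cf _ Uz)).
  by [].
split=> // i.
rewrite (funext (fun z => derive_lsubmx f z _)).
have [j ->|j ->] := split_ordP i.
  have lj : lsubmx (delta_mx 0 (lshift d j)) = delta_mx 0 j :> 'rV[R]_m.
    by apply/rowP => l; rewrite !mxE eq_lshift.
  have [dfj Cf] := df j; rewrite lj; split; last exact: (IH _ Cf).
  by move=> z Uz; rewrite derivable_lsubmx lj; exact: dfj.
have lj : lsubmx (delta_mx 0 (rshift m j)) = 0 :> 'rV[R]_m.
  by apply/rowP => l; rewrite !mxE eq_lrshift.
rewrite lj; split=> [z Uz|]; first by rewrite derivable_lsubmx lj; exact: derivable0.
have -> : (fun z : 'rV[R]_(m + d) => 'D_0 f (lsubmx z)) = fun=> 0.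
  by apply/funext => z; rewrite derive0.
exact: Ck_cst.
Qed.

End EuclideanSmoothness.

(** * Smooth functions, tangent vectors and vector fields *)

Section Fields.
Context {R : realType} {m : nat} {M : smooth_manifold R m}.
Implicit Types (f h : M -> R) (p : M) (u v w : functional M) (X Y Z : vfield M).

Lemma smooth_cst (a : R) : smooth M (fun=> a).
Proof. by move=> c _ k; exact: Ck_cst. Qed.

Lemma smooth_lin (a : R) f h :
  smooth M f -> smooth M h -> smooth M (fun p => a * f p + h p).
Proof.
move=> sf sh c ac k.
by apply: Ck_lin; [exact: chart_img_open|exact: sf|exact: sh].
Qed.

Lemma smoothZ (a : R) f : smooth M f -> smooth M (fun p => a * f p).
Proof.
move=> sf; have := smooth_lin a sf (smooth_cst 0).
by under eq_fun do rewrite addr0.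
Qed.

Lemma smoothD f h : smooth M f -> smooth M h -> smooth M (fun p => f p + h p).
Proof.
by move=> sf sh; have := smooth_lin 1 sf sh; under eq_fun do rewrite mul1r.
Qed.

Lemma smoothN f : smooth M f -> smooth M (fun p => - f p).
Proof. by move=> /(smoothZ (-1)); under eq_fun do rewrite mulN1r. Qed.

Lemma smoothB f h : smooth M f -> smooth M h -> smooth M (fun p => f p - h p).
Proof. by move=> sf /smoothN; exact: smoothD. Qed.

Lemma tangent_cst p v (a : R) : tangent M p v -> v (fun=> a) = 0.
Proof.
move=> [lin leib _].
have v1 : v (fun=> 1) = 0.
  have := leib _ _ (smooth_cst 1) (smooth_cst 1).
  by under eq_fun do rewrite mulr1; lra.
have := lin (a - 1) _ _ (smooth_cst 1) (smooth_cst 1).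
by under eq_fun do rewrite mulr1 subrK; rewrite v1 mulr0 addr0.
Qed.

Lemma tangentZ p v (a : R) f :
  tangent M p v -> smooth M f -> v (fun q => a * f q) = a * v f.
Proof.
move=> vp sf; have [lin _ _] := vp.
have := lin a _ _ sf (smooth_cst 0); rewrite (tangent_cst _ vp) addr0 => <-.
by congr v; apply/funext => q; rewrite addr0.
Qed.

Lemma tangentD p v f h : tangent M p v -> smooth M f -> smooth M h ->
  v (fun q => f q + h q) = v f + v h.
Proof.
move=> [lin _ _] sf sh; rewrite -[v f]mul1r -lin //.
by congr v; apply/funext => q; rewrite mul1r.
Qed.

(** Both sides are 0 when [f] is not smooth. *)
Lemma tangentN p v f : tangent M p v -> v (fun q => - f q) = - v f.
Proof.
move=> vp; have [sf|nsf] := pselect (smooth M f).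
  rewrite -mulN1r -(tangentZ _ vp sf).
  by congr v; apply/funext => q; rewrite mulN1r.
have [_ _ v0] := vp; rewrite !v0 ?oppr0 // => /smoothN.
by under eq_fun do rewrite opprK.
Qed.

Lemma tangentB p v f h : tangent M p v -> smooth M f -> smooth M h ->
  v (fun q => f q - h q) = v f - v h.
Proof.
by move=> vp sf sh; rewrite (tangentD vp sf (smoothN sh)) (tangentN _ vp).
Qed.

Lemma tangent_zero p : tangent M p (fun=> 0).
Proof. by split=> // *; rewrite !(mulr0, mul0r) addr0. Qed.

Lemma tangent_vadd p v w :
  tangent M p v -> tangent M p w -> tangent M p (vadd v w).
Proof.
move=> [vl vp v0] [wl wp w0]; rewrite /vadd; split.
- by move=> a f h sf sh; rewrite vl // wl //; ring.
- by move=> f h sf sh; rewrite vp // wp //; ring.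
- by move=> f nsf; rewrite v0 // w0 // addr0.
Qed.

Lemma tangent_vscale p (a : R) v : tangent M p v -> tangent M p (vscale a v).
Proof.
move=> [vl vp v0]; rewrite /vscale; split.
- by move=> b f h sf sh; rewrite vl //; ring.
- by move=> f h sf sh; rewrite vp //; ring.
- by move=> f nsf; rewrite v0 // mulr0.
Qed.

Lemma vsubE v w : vsub v w = vadd (vscale (-1) w) v.
Proof. by apply/funext => f; rewrite /vsub /vadd /vscale; ring. Qed.

Lemma tangent_vsub p v w :
  tangent M p v -> tangent M p w -> tangent M p (vsub v w).
Proof.
by move=> vp wp; rewrite vsubE; apply: tangent_vadd => //; exact: tangent_vscale.
Qed.

Lemma vsubvv v : vsub v v = fun=> 0.
Proof. by apply/funext => f; rewrite /vsub subrr. Qed.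

Lemma tangent_eq p v w : tangent M p v -> tangent M p w ->
  (forall f, smooth M f -> v f = w f) -> v = w.
Proof.
move=> [_ _ v0] [_ _ w0] vw; apply/funext => f.
by have [/vw//|nsf] := pselect (smooth M f); rewrite v0 // w0.
Qed.

Lemma field_tangent X p : vector_field M X -> tangent M p (X p).
Proof. by case. Qed.

Lemma field_app X f : vector_field M X -> smooth M f -> smooth M (app X f).
Proof. by move=> [_ +] sf; exact. Qed.

Lemma field_fsub X Y :
  vector_field M X -> vector_field M Y -> vector_field M (fsub X Y).
Proof.
move=> fX fY; split=> [p|f sf]; first by apply: tangent_vsub; exact: field_tangent.
by apply: smoothB; exact: field_app.
Qed.

Lemma field_fneg X : vector_field M X -> vector_field M (fscale (fun=> -1) X).
Proof.
move=> fX; split=> [p|f sf]; first by apply: tangent_vscale; exact: field_tangent.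
by apply: smoothZ; exact: field_app.
Qed.

Lemma field_zero : vector_field M (fun _ _ => 0).
Proof. by split=> [p|f sf]; [exact: tangent_zero|exact: smooth_cst]. Qed.

(** Smoothness of [f] is what allows a derivation to be distributed over the
    differences of second derivatives of [f]. *)
Lemma jacobi X Y Z p f : vector_field M X -> vector_field M Y ->
    vector_field M Z -> smooth M f ->
  bracket X (bracket Y Z) p f =
  bracket (bracket X Y) Z p f + bracket Y (bracket X Z) p f.
Proof.
move=> fX fY fZ sf; rewrite /bracket /app.
have s V W : vector_field M V -> vector_field M W ->
    smooth M (fun q => V q (fun q' => W q' f)).
  by move=> fV fW; exact: field_app fV (field_app fW sf).
have [sXY sYX] := (s _ _ fX fY, s _ _ fY fX).
have [sXZ sZX] := (s _ _ fX fZ, s _ _ fZ fX).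
have [sYZ sZY] := (s _ _ fY fZ, s _ _ fZ fY).
rewrite (tangentB (field_tangent p fX)) // (tangentB (field_tangent p fY)) //.
rewrite (tangentB (field_tangent p fZ)) //.
ring.
Qed.

Section OneForm.
Context (a : M -> functional M -> R) (af : one_form a).

Lemma one_formB p v w : tangent M p v -> tangent M p w ->
  a p (vsub v w) = a p v - a p w.
Proof. by case: af => l _ vp wp; rewrite vsubE l //; ring. Qed.

Lemma one_formD p v w : tangent M p v -> tangent M p w ->
  a p (vadd v w) = a p v + a p w.
Proof.
case: af => l _ vp wp; rewrite -[a p v]mul1r -l //; congr (a p _).
by apply/funext => f; rewrite /vadd /vscale mul1r.
Qed.

Lemma one_formZ p (c : R) v : tangent M p v -> a p (vscale c v) = c * a p v.
Proof.
move=> vp; have := one_formB vp vp; rewrite vsubvv subrr => a0.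
case: af => l _; rewrite -[RHS]addr0 -a0 -l //; last exact: tangent_zero.
by congr (a p _); apply/funext => f; rewrite /vadd addr0.
Qed.

Lemma one_form0 p : a p (fun=> 0) = 0.
Proof.
rewrite -(vsubvv (fun=> 0)) one_formB ?subrr //; exact: tangent_zero.
Qed.

Lemma one_form_smooth X : vector_field M X -> smooth M (fun p => a p (X p)).
Proof. by case: af => _; exact. Qed.

End OneForm.

Section Tensor.
Context (F : M -> functional M -> functional M) (Ft : tensor11 F).

Lemma tensor11B p v w : tangent M p v -> tangent M p w ->
  F p (vsub v w) = vsub (F p v) (F p w).
Proof. by case: Ft => _ l _ vp wp; rewrite !vsubE l. Qed.

Lemma tensor11_0 p : F p (fun=> 0) = fun=> 0.
Proof.
rewrite -(vsubvv (fun=> 0)) tensor11B ?vsubvv //; exact: tangent_zero.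
Qed.

Lemma tensor11N p v : tangent M p v -> F p (vscale (-1) v) = vscale (-1) (F p v).
Proof.
have E w : vscale (-1) w = vsub (fun=> 0) w :> functional M.
  by apply/funext => f; rewrite /vsub /vscale mulN1r sub0r.
by move=> vp; rewrite !E tensor11B ?tensor11_0 //; exact: tangent_zero.
Qed.

Lemma tensor11_field X :
  vector_field M X -> vector_field M (fun p => F p (X p)).
Proof. by case: Ft => _ _; exact. Qed.

End Tensor.

End Fields.

(** * The Levi-Civita connection and its curvature *)

Section LeviCivita.
Context {R : realType} {m : nat} {M : smooth_manifold R m}.
Context (g : M -> functional M -> functional M -> R)
  (nabla : vfield M -> vfield M -> vfield M).
Context (gm : riemannian_metric g) (lc : levi_civita g nabla).
Implicit Types (X Y Z U V : vfield M).

Definition inner X Y : M -> R := fun p => g p (X p) (Y p).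

Local Notation "<< X , Y >>" := (inner X Y).

Lemma metricB p u v w : tangent M p u -> tangent M p v -> tangent M p w ->
  g p (vsub u v) w = g p u w - g p v w.
Proof. by case: gm => _ l _ _ up vp wp; rewrite vsubE l //; ring. Qed.

Lemma metric0 p v : tangent M p v -> g p v (fun=> 0) = 0.
Proof.
case: gm => c _ _ _ vp; have t0 := tangent_zero p; rewrite c //.
by rewrite -(vsubvv (fun=> 0)) metricB // subrr.
Qed.

Lemma metricZ p (c : R) u w : tangent M p u -> tangent M p w ->
  g p (vscale c u) w = c * g p u w.
Proof.
case: gm => s l _ _ up wp; have t0 := tangent_zero p.
rewrite -[RHS]addr0 -(metric0 wp) (s _ w) // -l //; congr (g p _ w).
by apply/funext => f; rewrite /vadd addr0.
Qed.

Lemma metric_eq0 p v : tangent M p v -> g p v v = 0 -> v = fun=> 0.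
Proof.
case: gm => _ _ pos _ vp vv; have [//|/(pos _ _ vp)] := pselect (v = fun=> 0).
by rewrite vv ltxx.
Qed.

Lemma innerC X Y p : vector_field M X -> vector_field M Y ->
  << X, Y >> p = << Y, X >> p.
Proof. by case: gm => c _ _ _ fX fY; apply: c; exact: field_tangent. Qed.

Lemma inner_combl f X Y Z p :
  vector_field M X -> vector_field M Y -> vector_field M Z ->
  << fsub (fscale f X) Y, Z >> p = f p * << X, Z >> p - << Y, Z >> p.
Proof.
move=> fX fY fZ; have t := field_tangent p.
rewrite {1}/inner /fsub metricB ?metricZ //; try exact: t.
by apply: tangent_vscale; exact: t.
Qed.

Lemma innerBl X Y Z p :
  vector_field M X -> vector_field M Y -> vector_field M Z ->
  << fsub X Y, Z >> p = << X, Z >> p - << Y, Z >> p.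
Proof. by move=> fX fY fZ; apply: metricB; exact: field_tangent. Qed.

Lemma inner_smooth X Y :
  vector_field M X -> vector_field M Y -> smooth M << X, Y >>.
Proof. by case: gm => _ _ _; exact. Qed.

Lemma nabla_field X Y :
  vector_field M X -> vector_field M Y -> vector_field M (nabla X Y).
Proof. by case: lc => -[f _ _ _] _ _; exact: f. Qed.

(** Linearity of a connection in its direction is postulated for combinations
    [f X + Y], so [- Y] is written [(-1) Y + 0] and 0 as [(-1) Y + Y]. *)
Lemma nabla_combl f X Y Z : smooth M f ->
    vector_field M X -> vector_field M Y -> vector_field M Z ->
  nabla (fsub (fscale f X) Y) Z = fsub (fscale f (nabla X Z)) (nabla Y Z).
Proof.
case: lc => -[_ l _ _] _ _ sf fX fY fZ.
have s1 := smooth_cst (M := M) (-1).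
have E V W : fsub V W = fadd V (fscale (fun=> -1) W) :> vfield M.
  apply/funext => p; apply/funext => h.
  by rewrite /fsub /fadd /fscale /vsub /vadd /vscale mulN1r.
have V0 (V : vfield M) : fadd (fscale (fun=> -1) V) V = fun _ _ => 0.
  apply/funext => p; apply/funext => h.
  by rewrite /fadd /fscale /vadd /vscale mulN1r addNr.
have nabla0 : nabla (fun _ _ => 0) Z = fun _ _ => 0 by rewrite -{1}(V0 Y) l // V0.
have addV0 (V : vfield M) : fadd V (fun _ _ => 0) = V.
  by apply/funext => p; apply/funext => h; rewrite /fadd /vadd addr0.
rewrite !E l //; last exact: field_fneg.
rewrite -[fscale _ Y]addV0 l //; first by rewrite nabla0 addV0.
exact: field_zero.
Qed.

Lemma bracketE X Y : vector_field M X -> vector_field M Y ->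
  bracket X Y = fsub (nabla X Y) (nabla Y X).
Proof. by case: (lc) => _ t _ fX fY; rewrite t. Qed.

(** Torsion-freeness makes the derivation property of the bracket a consequence
    of that of [nabla X Y]. *)
Lemma bracket_field X Y :
  vector_field M X -> vector_field M Y -> vector_field M (bracket X Y).
Proof.
by move=> fX fY; rewrite bracketE //; apply: field_fsub; exact: nabla_field.
Qed.

Lemma inner_bracketl X Y Z p :
  vector_field M X -> vector_field M Y -> vector_field M Z ->
  << bracket X Y, Z >> p = << nabla X Y, Z >> p - << nabla Y X, Z >> p.
Proof.
by move=> fX fY fZ; rewrite bracketE // innerBl //; exact: nabla_field.
Qed.

Lemma app_inner X Y Z p :
  vector_field M X -> vector_field M Y -> vector_field M Z ->
  X p << Y, Z >> = << nabla X Y, Z >> p + << Y, nabla X Z >> p.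
Proof. by case: lc => _ _ c fX fY fZ; exact: c. Qed.

Lemma app_app_inner X Y Z U p : vector_field M X -> vector_field M Y ->
    vector_field M Z -> vector_field M U ->
  X p (app Y << Z, U >>) =
    << nabla X (nabla Y Z), U >> p + << nabla Y Z, nabla X U >> p +
    (<< nabla X Z, nabla Y U >> p + << Z, nabla X (nabla Y U) >> p).
Proof.
move=> fX fY fZ fU; have fN := nabla_field; have i := inner_smooth.
rewrite (_ : app Y _ = fun q => << nabla Y Z, U >> q + << Z, nabla Y U >> q).
  rewrite (tangentD (field_tangent p fX)); try by apply: (i) => //; exact: fN.
  by rewrite !app_inner //; exact: fN.
by apply/funext => q; exact: app_inner.
Qed.

Lemma inner_curvature X Y Z U p : vector_field M X -> vector_field M Y ->
    vector_field M Z -> vector_field M U ->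
  << curvature nabla X Y Z, U >> p =
    << nabla X (nabla Y Z), U >> p - << nabla Y (nabla X Z), U >> p
    - << nabla (bracket X Y) Z, U >> p.
Proof.
move=> fX fY fZ fU; have fN := nabla_field.
rewrite /curvature !innerBl //; try exact: fN.
- by apply: (fN) => //; exact: fN.
- by apply: (fN) => //; exact: fN.
- by apply: field_fsub; apply: (fN) => //; exact: fN.
- by apply: (fN) => //; exact: bracket_field.
Qed.

Lemma curvature_field X Y Z : vector_field M X -> vector_field M Y ->
  vector_field M Z -> vector_field M (curvature nabla X Y Z).
Proof.
move=> fX fY fZ; have fN := nabla_field; have fb := bracket_field fX fY.
by apply: field_fsub; [apply: field_fsub|]; apply: (fN) => //; exact: fN.
Qed.

Lemma nabla_curvature_field W X Y Z :
    vector_field M W -> vector_field M X -> vector_field M Y ->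
    vector_field M Z ->
  vector_field M (nabla_curvature nabla W X Y Z).
Proof.
move=> fW fX fY fZ; have fN := nabla_field; have fR := curvature_field.
apply: field_fsub; last by apply: (fR) => //; exact: fN.
apply: field_fsub; last by apply: (fR) => //; exact: fN.
by apply: field_fsub; [apply: (fN) => //; exact: fR|apply: (fR) => //; exact: fN].
Qed.

(** The second covariant derivatives of [g] vanish: [X Y <Z,U> - Y X <Z,U>] is
    [[X,Y]<Z,U>], and expanding both sides by metric compatibility the mixed
    terms cancel. *)
Lemma curvature_skew X Y Z U p : vector_field M X -> vector_field M Y ->
    vector_field M Z -> vector_field M U ->
  << curvature nabla X Y Z, U >> p = - << curvature nabla X Y U, Z >> p.
Proof.
move=> fX fY fZ fU; have fN := nabla_field; have fb := bracket_field fX fY.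
have : bracket X Y p << Z, U >> =
    X p (app Y << Z, U >>) - Y p (app X << Z, U >>) by [].
rewrite !app_app_inner // app_inner // !inner_curvature //.
rewrite (innerC p fZ (fN _ _ fX (fN _ _ fY fU))).
rewrite (innerC p fZ (fN _ _ fY (fN _ _ fX fU))).
rewrite (innerC p fZ (fN _ _ fb fU)).
lra.
Qed.

(** For the Levi-Civita connection this skew-symmetry of [nabla xi] is the
    equation [L_xi g = 0]. *)
Definition killing (xi : vfield M) : Prop :=
  forall X Y, vector_field M X -> vector_field M Y -> forall p,
    << nabla X xi, Y >> p = - << nabla Y xi, X >> p.

(** The term [nabla_X nabla_xi xi] drops out. By skew-symmetry
    [<nabla_X xi, X> = 0]; differentiating this along [xi] turns the second
    term of the curvature into [<nabla_X xi, nabla_xi X>], which cancels against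
    one of the two parts of [<nabla_[X,xi] xi, X> = - <nabla_X xi, [X,xi]>] and
    leaves [|nabla_X xi|^2]. *)
Lemma curvature_killing xi X p : vector_field M xi -> killing xi ->
    (forall Y q, vector_field M Y -> << nabla xi xi, Y >> q = 0) ->
    vector_field M X ->
  << curvature nabla X xi xi, X >> p = << nabla X xi, nabla X xi >> p.
Proof.
move=> fxi kxi geo fX; have fN := nabla_field.
have fb := bracket_field fX fxi.
rewrite inner_curvature // (kxi _ _ fb fX).
rewrite -(innerC p fb (fN _ _ fX fxi)) inner_bracketl //; last exact: fN.
(* Differentiate [<nabla_xi xi, X> = 0] along [X], then [<nabla_X xi, X> = 0]
   along [xi]. *)
have : X p << nabla xi xi, X >> = 0.
  rewrite (_ : << _, _ >> = fun=> 0); last by apply/funext => q; exact: geo.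
  exact: tangent_cst (field_tangent p fX).
rewrite app_inner //; last exact: fN.
rewrite geo; last exact: fN.
have : xi p << nabla X xi, X >> = 0.
  rewrite (_ : << _, _ >> = fun=> 0); last first.
    by apply/funext => q; have := kxi _ _ fX fX q; lra.
  exact: tangent_cst (field_tangent p fxi).
rewrite app_inner //; last exact: fN.
rewrite (innerC p (fN _ _ fX fxi) (fN _ _ fxi fX)).
lra.
Qed.

End LeviCivita.

(** * Fields on the cylinder that do not depend on t *)

Section CylinderLift.
Context {R : realType} {m : nat} {M : smooth_manifold R m}.
Implicit Types (X Y : vfield M) (f h : M -> R).

(** The field [X + f d/dt] with [X] and [f] constant in [t]. Such fields are
    closed under brackets and under [J], and [d/dt] is one of them; the torsion
    of [J] on them is thus computed on [M]. *)
Definition cyl_lift X f : cyl_field M := (fun q => X q.1, fun q => f q.1).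

Lemma smooth_cyl_fst h : smooth M h -> smooth_cyl (fun q : M * R => h q.1).
Proof.
move=> sh c ac k.
exact: (Ck_lsubmx 1 (f := fun x => h (chart_inv c x)) (sh c ac k)).
Qed.

Lemma cyl_lift_field X f :
  vector_field M X -> smooth M f -> cyl_vector_field (cyl_lift X f).
Proof.
move=> fX sf; split=> [q|h sh|]; first exact: field_tangent.
  exact: smooth_cyl_fst (field_app fX sh).
exact: smooth_cyl_fst.
Qed.

Lemma cyl_app_lift X f h (q : M * R) :
  cyl_app (cyl_lift X f) (fun q => h q.1) q = X q.1 h.
Proof. by rewrite /cyl_app /= derive1_cst mulr0 addr0. Qed.

Lemma cyl_bracket_lift X Y f h :
  cyl_bracket (cyl_lift X f) (cyl_lift Y h) =
  cyl_lift (bracket X Y) (fun p => X p h - Y p f).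
Proof.
congr (_, _); apply/funext => q; last by rewrite !cyl_app_lift.
apply/funext => k.
by rewrite (cyl_app_lift X f (app Y k)) (cyl_app_lift Y h (app X k)).
Qed.

End CylinderLift.

(** * The Reeb field of a contact metric manifold *)

Section ContactMetric.
Context {R : realType} {n : nat} {M : smooth_manifold R n.*2.+1}.
Context (S : contact_metric M) (nabla : vfield M -> vfield M -> vfield M).
Context (lc : levi_civita (g S) nabla).
Implicit Types (X Y Z W : vfield M) (p : M).

Local Notation "<< X , Y >>" := (inner (g S) X Y).
Local Notation xi := (xi S).
Local Notation eta := (eta S).
Local Notation Phi X := (fun p => phi S p (X p)).

Let gm := g_metric S.
Let fxi : vector_field M xi := xi_field S.
Let fN := nabla_field lc.

Lemma phi_field X : vector_field M X -> vector_field M (Phi X).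
Proof. exact: (tensor11_field (phi_tensor S)). Qed.

(** As [phi^2 xi = 0], compatibility of [g] with [phi] gives
    [eta (phi xi) = <xi, phi xi> = d eta(xi,xi) = 0] and then
    [|phi xi|^2 = (eta (phi xi))^2 = 0]. *)
Lemma phi_xi p : phi S p (xi p) = fun=> 0.
Proof.
have fF := phi_field fxi.
have deta0 : ext_deriv eta xi xi p = 0.
  rewrite /ext_deriv subrr sub0r (_ : bracket xi xi p = fun=> 0).
    by rewrite (one_form0 (eta_form S)) oppr0 mulr0.
  by apply/funext => f; rewrite /bracket subrr.
rewrite (deta_g S fxi fxi) in deta0.
have phi2 : phi S p (phi S p (xi p)) = fun=> 0.
  rewrite phi_phi // eta_xi; apply/funext => f.
  by rewrite /vsub /vscale mul1r subrr.
have := g_phi S fxi fF p; have := g_phi S fF fF p.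
have tF := field_tangent p fF; have t0 := tangent_zero p.
rewrite phi2 eta_xi deta0 !(metric0 gm) //.
rewrite mul1r sub0r => gF e0.
apply: (metric_eq0 gm tF).
have {}e0 : eta p (phi S p (xi p)) = 0 by lra.
by move: gF; rewrite e0 mulr0 subr0.
Qed.

Lemma eta_inner X p : vector_field M X -> eta p (X p) = << X, xi >> p.
Proof.
move=> fX; have := g_phi S fX fxi p.
rewrite phi_xi (metric0 gm) ?eta_xi; last exact: field_tangent (phi_field fX).
by rewrite /inner; lra.
Qed.

(** [xi] has constant length 1. *)
Lemma inner_nabla_xi_xi X p : vector_field M X -> << nabla X xi, xi >> p = 0.
Proof.
move=> fX; have : X p << xi, xi >> = 0.
  rewrite (_ : << _, _ >> = fun=> 1); first exact: tangent_cst (field_tangent p fX).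
  by apply/funext => q; rewrite -eta_inner // eta_xi.
rewrite (app_inner lc) // (innerC gm p fxi (fN fX fxi)); lra.
Qed.

Lemma ext_deriv_eta X Y p : vector_field M X -> vector_field M Y ->
  ext_deriv eta X Y p = 2^-1 * (<< nabla X xi, Y >> p - << nabla Y xi, X >> p).
Proof.
move=> fX fY; rewrite /ext_deriv.
rewrite (funext (fun q => eta_inner q fY)) (funext (fun q => eta_inner q fX)).
rewrite (eta_inner p (bracket_field lc fX fY)) (inner_bracketl gm lc) //.
rewrite !(app_inner lc) // (innerC gm p fY (fN fX fxi)).
by rewrite (innerC gm p fX (fN fY fxi)); congr (_ * _); ring.
Qed.

Lemma inner_phi X Y p : vector_field M X -> vector_field M Y ->
  << X, Phi Y >> p = 2^-1 * (<< nabla X xi, Y >> p - << nabla Y xi, X >> p).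
Proof. by move=> fX fY; rewrite -ext_deriv_eta // deta_g. Qed.

Lemma eta_phi X p : vector_field M X -> eta p (phi S p (X p)) = 0.
Proof.
move=> fX; rewrite (eta_inner p (phi_field fX)) (innerC gm) //; last exact: phi_field.
have := inner_phi p fX fxi; have := inner_phi p fxi fX.
rewrite /inner phi_xi (metric0 gm); last exact: field_tangent.
lra.
Qed.

(** [<nabla_xi xi, X> - <nabla_X xi, xi> = 2 d eta(xi,X) = 2 <xi, phi X> = 0],
    and the second term vanishes. *)
Lemma xi_geodesic X p : vector_field M X -> << nabla xi xi, X >> p = 0.
Proof.
move=> fX; have := inner_phi p fxi fX; rewrite inner_nabla_xi_xi //.
rewrite (innerC gm p fxi (phi_field fX)) -(eta_inner p (phi_field fX)) eta_phi //.
lra.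
Qed.

(** This is [L_xi eta = 0]. *)
Lemma eta_bracket_xi X p :
  vector_field M X -> eta p (bracket xi X p) = xi p (fun q => eta q (X q)).
Proof.
move=> fX; rewrite (funext (fun q => eta_inner q fX)).
rewrite (eta_inner p (bracket_field lc fxi fX)) (inner_bracketl gm lc) //.
rewrite (app_inner lc) // (innerC gm p fX (fN fxi fxi)) xi_geodesic //.
by rewrite inner_nabla_xi_xi //; ring.
Qed.

(** This is [L_xi (d eta) = d (L_xi eta) = 0]; commuting [L_xi] with [d] amounts
    to the Jacobi identity. *)
Lemma lie_xi_ext_deriv X Y p : vector_field M X -> vector_field M Y ->
  xi p (ext_deriv eta X Y) =
  ext_deriv eta (bracket xi X) Y p + ext_deriv eta X (bracket xi Y) p.
Proof.
move=> fX fY; have fb := bracket_field lc.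
have se Z : vector_field M Z -> smooth M (fun q => eta q (Z q)).
  exact: (one_form_smooth (eta_form S)).
have sX := field_app fX (se _ fY); have sY := field_app fY (se _ fX).
have sXY := se _ (fb _ _ fX fY).
rewrite /ext_deriv (tangentZ _ (field_tangent p fxi)); last first.
  by apply: smoothB => //; exact: smoothB.
rewrite (tangentB (field_tangent p fxi) (smoothB sX sY) sXY).
rewrite (tangentB (field_tangent p fxi) sX sY).
rewrite -(eta_bracket_xi p (fb _ _ fX fY)).
rewrite (funext (fun q => eta_bracket_xi q fX)).
rewrite (funext (fun q => eta_bracket_xi q fY)).
have -> : eta p (bracket xi (bracket X Y) p) =
    eta p (bracket (bracket xi X) Y p) + eta p (bracket X (bracket xi Y) p).
  have t1 := field_tangent p (fb _ _ (fb _ _ fxi fX) fY).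
  have t2 := field_tangent p (fb _ _ fX (fb _ _ fxi fY)).
  have t3 := field_tangent p (fb _ _ fxi (fb _ _ fX fY)).
  rewrite -(one_formD (eta_form S)) //; congr (eta p _).
  apply: (tangent_eq t3); first exact: tangent_vadd.
  by move=> f sf; exact: jacobi.
rewrite /bracket /app; ring.
Qed.

(** * The Reeb field of a Sasakian manifold *)

Context (sas : sasakian S).

Lemma cyl_J_lift X f :
  cyl_J S (cyl_lift X f) =
  cyl_lift (fsub (Phi X) (fscale f xi)) (fun p => eta p (X p)).
Proof. by []. Qed.

(** The torsion on [(X, d/dt)]: as [J (d/dt) = - xi] and [d/dt] commutes with
    all lifted fields, only [[J X, J d/dt]] and [J [X, J d/dt]] contribute, and
    the components along [M] are [- [phi X, xi]] and [- phi [X, xi]]. *)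
Lemma bracket_phi_xi X : vector_field M X ->
  bracket (Phi X) xi = Phi (bracket X xi).
Proof.
move=> fX; have fF := phi_field fX; have fb := bracket_field lc fX fxi.
pose O : vfield M := fun _ _ => 0.
have fO : vector_field M O := field_zero.
have := sas (cyl_lift_field fX (smooth_cst 0)) (cyl_lift_field fO (smooth_cst 1)).
have phiO : Phi O = O by apply/funext => p; exact: tensor11_0 (phi_tensor S) p.
have etaO : (fun p => eta p (O p)) = fun=> 0.
  by apply/funext => p; exact: one_form0 (eta_form S) p.
have bO Y : vector_field M Y -> bracket Y O = O.
  move=> fY; apply/funext => p; apply/funext => f.
  by rewrite /bracket (tangent_cst _ (field_tangent p fY)) subr0.
have JX : cyl_J S (cyl_lift X (fun=> 0)) = cyl_lift (Phi X) (fun p => eta p (X p)).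
  rewrite cyl_J_lift; congr cyl_lift; apply/funext => p; apply/funext => f.
  by rewrite /fsub /vsub /fscale /vscale mul0r subr0.
have JO : cyl_J S (cyl_lift O (fun=> 0)) = cyl_lift O (fun=> 0).
  rewrite cyl_J_lift phiO etaO; congr cyl_lift; apply/funext => p; apply/funext => f.
  by rewrite /fsub /vsub /fscale /vscale mul0r subr0.
have JT : cyl_J S (cyl_lift O (fun=> 1)) = cyl_lift (fscale (fun=> -1) xi) (fun=> 0).
  rewrite cyl_J_lift phiO etaO; congr cyl_lift; apply/funext => p; apply/funext => f.
  by rewrite /fsub /vsub /fscale /vscale /O; ring.
have brO Y f : vector_field M Y ->
    cyl_bracket (cyl_lift Y f) (cyl_lift O (fun=> 1)) = cyl_lift O (fun=> 0).
  move=> fY; rewrite cyl_bracket_lift bO //; congr cyl_lift; apply/funext => p.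
  by rewrite (tangent_cst _ (field_tangent p fY)) subr0.
have bN Y : vector_field M Y ->
    bracket Y (fscale (fun=> -1) xi) = fscale (fun=> -1) (bracket Y xi).
  move=> fY; apply/funext => p; apply/funext => f.
  rewrite /bracket /fscale /vscale /app.
  have -> : (fun q => -1 * xi q f) = fun q => - xi q f.
    by apply/funext => q; rewrite mulN1r.
  by rewrite (tangentN _ (field_tangent p fY)); ring.
rewrite /nijenhuis JX JT !brO // !JO.
rewrite !cyl_bracket_lift !bN // !cyl_J_lift.
move=> /(congr1 fst) N; apply/funext => p; apply/funext => f.
have {N} := congr1 (fun F : M * R -> functional M => F (p, 0) f) N.
rewrite /= /vsub /vadd /fsub /fscale /vsub /vscale /O /=.
rewrite (tensor11N (phi_tensor S)); last exact: field_tangent.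
rewrite !(tangent_cst _ (field_tangent _ _)) //.
rewrite /vscale; lra.
Qed.

(** This is [L_xi phi = 0]. *)
Lemma bracket_xi_phi X : vector_field M X ->
  bracket xi (Phi X) = Phi (bracket xi X).
Proof.
move=> fX; have fb := bracket_field lc fX fxi.
have E Y Z : bracket Y Z = fscale (fun=> -1) (bracket Z Y).
  apply/funext => p; apply/funext => f.
  by rewrite /fscale /vscale /bracket; ring.
rewrite E bracket_phi_xi // [bracket xi X]E; apply/funext => p.
by rewrite /fscale (tensor11N (phi_tensor S)) //; exact: field_tangent.
Qed.

(** [K Y = (L_xi g)(X, Y)] vanishes on the image of [phi] because
    [<X, phi Z> = d eta(X,Z)] and both [phi] and [d eta] are invariant under
    [xi]. Applied to [phi^2 Y = eta(Y) xi - Y] this is [K Y = eta(Y) K xi], and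
    [K xi = 0]. *)
Lemma killing_xi : killing (g S) nabla xi.
Proof.
move=> X Y fX fY p; have fb := bracket_field lc.
pose K Y := << nabla X xi, Y >> p + << nabla Y xi, X >> p.
have Kphi Z : vector_field M Z -> K (Phi Z) = 0.
  move=> fZ; have fF := phi_field fZ; rewrite /K.
  have := lie_xi_ext_deriv p fX fZ.
  rewrite (funext (fun q => deta_g S fX fZ q)) !deta_g //; try exact: fb.
  have -> : phi S p (bracket xi Z p) = bracket xi (Phi Z) p.
    by rewrite bracket_xi_phi.
  rewrite -[fun q => _]/(<< X, Phi Z >>) -[g S p _ (phi S p _)]/(<< bracket xi X, Phi Z >> p).
  rewrite -[g S p _ (bracket _ _ _)]/(<< X, bracket xi (Phi Z) >> p).
  rewrite (app_inner lc) // (innerC gm p fX (fb _ _ fxi fF)).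
  rewrite !(inner_bracketl gm lc) // (innerC gm p fX (fN fxi fF)).
  by lra.
have KphiY := Kphi _ (phi_field fY).
have E : Phi (Phi Y) = fsub (fscale (fun q => eta q (Y q)) xi) Y.
  by apply/funext => q; rewrite phi_phi.
have sf := one_form_smooth (eta_form S) fY.
have fFF := phi_field (phi_field fY).
move: KphiY; rewrite /K (innerC gm p (fN fX fxi) fFF) E.
rewrite (nabla_combl lc) // !(inner_combl gm) //; try exact: fN.
rewrite -(innerC gm p (fN fX fxi) fY) -(innerC gm p (fN fX fxi) fxi).
rewrite inner_nabla_xi_xi // xi_geodesic //; lra.
Qed.

End ContactMetric.

(** * Non-existence of phi-recurrent Sasakian manifolds *)

Theorem theorem3p4 (R : realType) (n : nat) (M : smooth_manifold R n.*2.+1)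
    (S : contact_metric M) (nabla : vfield M -> vfield M -> vfield M) :
  (1 <= n)%N -> levi_civita (g S) nabla -> sasakian S ->
  ~ phi_recurrent S nabla.
Proof.
move=> n1 lc sas [A [_ [W fW [p ApW]] recur]].
have fxi := xi_field S; have gm := g_metric S; have kxi := killing_xi lc sas.
(* [eta] kills the left-hand side of the recurrence identity. *)
have curv0 X Y Z : vector_field M X -> vector_field M Y -> vector_field M Z ->
    inner (g S) (curvature nabla X Y Z) (xi S) p = 0.
  move=> fX fY fZ.
  have fD := nabla_curvature_field lc fW fX fY fZ.
  have fR := curvature_field lc fX fY fZ.
  have := congr1 (eta S p) (recur _ _ _ _ fX fY fZ fW p).
  rewrite phi_phi // (one_formB (eta_form S)); first last.
  - exact: field_tangent.
  - by apply: tangent_vscale; exact: field_tangent.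
  rewrite !(one_formZ (eta_form S)) ?eta_xi; try exact: field_tangent.
  rewrite mulr1 subrr -(eta_inner S p fR) => /esym/eqP.
  by rewrite mulf_eq0 (negPf ApW) => /eqP.
have nabla_xi0 X : vector_field M X -> nabla X (xi S) p = fun=> 0.
  move=> fX; have fXxi := nabla_field lc fX fxi.
  apply: (metric_eq0 gm); first exact: field_tangent.
  have := curvature_killing gm lc p fxi kxi (fun Y q => xi_geodesic lc q) fX.
  rewrite (curvature_skew gm lc) // curv0 // oppr0 => /esym; exact.
have [V fV] := eta_contact S p; apply/negP; rewrite negbK.
rewrite /contact_volume big1 // => s _.
(* Each product has a factor of index 0 because [n >= 1]. *)
rewrite (bigD1 (Ordinal n1)) //= (ext_deriv_eta lc) // /inner !nabla_xi0 //.
have g0 v : tangent M p v -> g S p (fun=> 0) v = 0.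
  by case: (gm) => c _ _ _ vp; rewrite c ?metric0 //; exact: tangent_zero.
rewrite !g0; try exact: field_tangent.
by rewrite subrr mulr0 mul0r mulr0.
Qed.
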